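(* Let $A$ be a Banach algebra with a right identity $e$. If $eA$ is commutative and semisimple, then every Jordan derivation $d$ on $A$ is a derivation. Furthermore, $d$ is spectrally infinitesimal and $d(A)$ is contained in $\operatorname{ran}(A)$.
   Context: Banach algebras are over $\mathbb{C}$ and associative, and are not assumed to be commutative or unital. A right identity of $A$ is an element $e \in A$ with $ae = a$ for all $a \in A$; then $eA = \{ea : a \in A\}$ is a closed subalgebra of $A$. Semisimple means that the (Jacobson) radical is $\{0\}$. The right annihilator of $A$ is $\operatorname{ran}(A) = \{r \in A : ar = 0 \text{ for all } a \in A\}$. A linear map $d: A \to A$ (not assumed continuous) is a derivation if $d(ax) = d(a)x + a\,d(x)$ for all $a, x \in A$, and a Jordan derivation if $d(a^2) = d(a)a + a\,d(a)$ for all $a \in A$. A linear map $T: A \to A$ is spectrally infinitesimal if $r(T(a)) = 0$ for all $a \in A$, where $r(\cdot)$ denotes the spectral radius, $r(a) = \lim_{n\to\infty} \|a^n\|^{1/n}$. *)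

(* Defs.v *)
From HB Require Import structures.
From mathcomp Require Import all_boot all_order all_algebra.
From mathcomp Require Import complex.
From mathcomp Require Import all_classical all_reals all_analysis.

Set Implicit Arguments.
Unset Strict Implicit.
Unset Printing Implicit Defensive.

Import Order.TTheory GRing.Theory Num.Theory.
Import numFieldNormedType.Exports.

Local Open Scope classical_set_scope.
Local Open Scope ring_scope.
Local Open Scope complex_scope.

(* MathComp's rings are unital, so the product of a possibly non-unital
   algebra is added on top of a complex Banach space as a separate operation. *)
HB.mixin Record isBanachAlgebra (R : realType) A
    of CompleteNormedModule R[i] A := {
  bmul : A -> A -> A;
  bmulA : associative bmul;
  bmulDl : left_distributive bmul +%R;
  bmulDr : right_distributive bmul +%R;
  bmulZl : forall (k : R[i]) (a b : A), bmul (k *: a) b = k *: bmul a b;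
  bmulZr : forall (k : R[i]) (a b : A), bmul a (k *: b) = k *: bmul a b;
  bnormM : forall a b : A, `|bmul a b| <= `|a| * `|b|
}.

#[short(type="banachAlgType")]
HB.structure Definition BanachAlgebra (R : realType) :=
  {A of CompleteNormedModule R[i] A & isBanachAlgebra R A}.

Notation "a ** b" := (bmul a b) (at level 40, left associativity) : ring_scope.

Section BanachAlgebraNotions.
Variables (R : realType) (A : banachAlgType R).
Implicit Types (a b e x : A) (B I J : set A) (d T : {linear A -> A}).

Definition right_identity e : Prop := forall a, a ** e = a.

Definition left_multiples e : set A := [set e ** a | a in setT].

Definition commutative_on B : Prop :=
  forall x y, B x -> B y -> x ** y = y ** x.

(* Below, B is (the underlying set of) a subalgebra of A, regarded as an
   algebra in its own right. *)
Definition left_ideal B I : Prop :=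
  [/\ I `<=` B, I 0, (forall x y, I x -> I y -> I (x + y)),
      (forall (k : R[i]) x, I x -> I (k *: x))
    & (forall b x, B b -> I x -> I (b ** x))].

Definition modular B I : Prop :=
  exists2 u, B u & forall b, B b -> I (b - b ** u).

Definition maximal_left_ideal B I : Prop :=
  [/\ left_ideal B I, I <> B
    & forall J, left_ideal B J -> I `<=` J -> J = I \/ J = B].

Definition jacobson_radical B : set A :=
  [set x | B x /\
     forall I, maximal_left_ideal B I -> modular B I -> I x].

Definition semisimple B : Prop := jacobson_radical B = [set 0].

Definition right_annihilator : set A := [set x | forall a, a ** x = 0].

Definition derivation d : Prop :=
  forall a x, d (a ** x) = d a ** x + a ** d x.

Definition jordan_derivation d : Prop :=
  forall a, d (a ** a) = d a ** a + a ** d a.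

(* bpowS a n is the power of a with exponent n.+1. *)
Definition bpowS a (n : nat) : A := iter n (bmul a) a.

(* The norm of A takes its values in the nonnegative reals of R[i]. *)
Definition rnorm a : R := complex.Re `|a|.

Definition spectral_seq a : R^nat :=
  fun n => rnorm (bpowS a n) `^ (n.+1%:R^-1).

Definition spectral_radius a : R := limn (spectral_seq a).

Definition spectrally_infinitesimal T : Prop :=
  forall a, spectral_radius (T a) = 0.

Lemma rnormE a : `|a| = (rnorm a)%:C.
Proof.
by rewrite /rnorm; have := ger0_Im (normr_ge0 a); case: `|a| => u v /= ->.
Qed.

Lemma rnorm_ge0 a : 0 <= rnorm a.
Proof. by have := normr_ge0 a; rewrite rnormE lecR. Qed.

Lemma rnormM a b : rnorm (a ** b) <= rnorm a * rnorm b.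
Proof. by have := bnormM a b; rewrite !rnormE -rmorphM lecR. Qed.

Lemma bpowSD a m n : bpowS a (m + n).+1 = bpowS a m ** bpowS a n.
Proof.
elim: m => [|m IH] //.
by rewrite addSn {1}/bpowS iterS -/(bpowS a (m + n).+1) IH bmulA.
Qed.

Lemma rnorm_bpowS_bound a m (c : R) : 0 < c -> rnorm (bpowS a m) <= c ^+ m.+1 ->
  exists2 K : R, 1 <= K & forall n, rnorm (bpowS a n) <= K * c ^+ n.+1.
Proof.
move=> c0 um; pose v i := rnorm (bpowS a i) / c ^+ i.+1.
have v0 i : 0 <= v i by rewrite divr_ge0 ?rnorm_ge0// exprn_ge0// ltW.
have K1 : 1 <= 1 + \sum_(i < m.+1) v i by rewrite lerDl sumr_ge0.
exists (1 + \sum_(i < m.+1) v i) => // n.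
elim/ltn_ind: n => n IH; have [nm|mn] := leqP n m.
  rewrite -ler_pdivrMr ?exprn_gt0// -/(v n) (bigD1 (Ordinal (nm : (n < m.+1)%N)))//=.
  by rewrite addrCA lerDl addr_ge0// sumr_ge0.
have -> : n = (m + (n - m.+1)).+1 by rewrite -addSn subnKC.
set k := (n - m.+1)%N; rewrite bpowSD (le_trans (rnormM _ _))//.
have kn : (k < n)%N by rewrite /k ltn_subrL/= (leq_ltn_trans _ mn).
rewrite (le_trans (ler_pM (rnorm_ge0 _) (rnorm_ge0 _) um (IH _ kn)))//.
by rewrite mulrCA -exprD addSn addnS.
Qed.

Lemma is_cvg_spectral_seq a : cvgn (spectral_seq a).
Proof.
pose s := spectral_seq a; pose L := inf (range s).
have s0 n : 0 <= s n by exact: powR_ge0.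
have hs : has_inf (range s).
  by split; [exists (s 0%N), 0%N|exists 0 => _ [n _ <-]].
have Ls n : L <= s n by apply: ge_inf; [exact: hs.2|exists n].
have L0 : 0 <= L by apply: lb_le_inf; [exact: hs.1|move=> _ [n _ <-]].
apply/cvg_ex; exists L; apply/cvgrPdist_le => /= eps eps0.
have e20 : 0 < eps / 2 by rewrite divr_gt0.
have [_ [m _ <-] sm] := inf_adherent e20 hs.
pose c := L + eps / 2; have c0 : 0 < c by rewrite ltr_wpDl.
have um : rnorm (bpowS a m) <= c ^+ m.+1.
  have -> : rnorm (bpowS a m) = s m ^+ m.+1.
    rewrite -powR_mulrn// /s /spectral_seq -powRrM mulVf ?pnatr_eq0//.
    by rewrite powRr1// rnorm_ge0.
  by rewrite lerXn2r ?nnegrE// ltW.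
have [K K1 uK] := rnorm_bpowS_bound c0 um.
have K0 : 0 < K by exact: lt_le_trans K1.
have sK n : s n <= K `^ (n.+1%:R^-1) * c.
  have -> : K `^ (n.+1%:R^-1) * c = (K * c ^+ n.+1) `^ (n.+1%:R^-1).
    rewrite powRM ?exprn_ge0// ?ltW//; congr (_ * _).
    by rewrite -powR_mulrn ?ltW// -powRrM mulfV ?pnatr_eq0// powRr1// ltW.
  by apply: ge0_ler_powR; rewrite ?nnegrE ?rnorm_ge0 ?invr_ge0 ?mulr_ge0
    ?exprn_ge0// ltW.
have cvK : K `^ (n.+1%:R^-1) * c @[n --> \oo] --> c.
  have h : expR (n.+1%:R^-1 * ln K) @[n --> \oo] --> expR (0 * ln K).
    apply: continuous_cvg; first exact: continuous_expR.
    by apply: cvgMr_tmp; exact: cvg_harmonic.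
  rewrite mul0r expR0 in h; rewrite -[X in _ --> X]mul1r; apply: cvgMr_tmp.
  by rewrite /powR gt_eqF.
move/cvgrPdist_le : cvK => /(_ _ e20); apply: filterS => n /= hn.
rewrite distrC ger0_norm ?subr_ge0// lerBlDl.
rewrite (le_trans (sK n))//.
move: hn; rewrite distrC ler_norml lerBlDr => /andP[_ /le_trans]; apply.
by rewrite /c addrCA -splitr.
Qed.

End BanachAlgebraNotions.

Arguments right_annihilator {R} A.

(* Main.v *)
(* Since x (a - e a) = 0, A is the sum of e A and ran(A), and a |-> e a is a
   homomorphism onto e A.  A Jordan derivation d induces the Jordan derivation
   e d on the commutative algebra e A, which is a derivation, hence zero by the
   theorems of Singer-Wermer and Johnson.  Testing d on products with e then
   gives e d(A) = 0, that is d(A) <= ran(A); so d(a^2) = d(a) a, polarization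
   gives d(a b) = d(a) b, and d(a)^2 = 0 makes the spectral radius vanish.

   For a derivation D on a commutative semisimple unital Banach algebra, let s
   be a separating element: x_n --> 0 and D x_n --> s.  If s <> 0, either a
   gliding hump built from elements of successive maximal ideals produces z
   with |D z| infinite, or some multiple t <> 0 of s is annihilated by a maximal
   ideal; in that case t generates a copy of C with unit an idempotent p, and
   D p = 0 forces p t = 0.  So D is bounded by the closed graph theorem, and
   then D^n (a^n) = n! (D a)^n modulo a maximal ideal containing a forces D a
   into that ideal.  Gelfand-Mazur identifies the quotient fields with C. *)
From HB Require Import structures.
Require Import Defs.
From mathcomp Require Import all_boot all_order all_algebra.
From mathcomp Require Import complex.
From mathcomp Require Import all_classical all_reals all_analysis.
From mathcomp Require Import ring lra.

Set Implicit Arguments.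
Unset Strict Implicit.
Unset Printing Implicit Defensive.

Import Order.TTheory GRing.Theory Num.Theory.
Import numFieldNormedType.Exports.
Import ComplexField.

Local Open Scope classical_set_scope.
Local Open Scope ring_scope.
Local Open Scope complex_scope.

Local Notation cmod := Normc.normc.

(** * The complex modulus and powers of scalars *)

Lemma normc_ge0 (R : rcfType) (z : R[i]) : 0 <= cmod z.
Proof. by case: z => x y; rewrite /cmod sqrtr_ge0. Qed.

Lemma normc_real (R : rcfType) (t : R) : cmod t%:C = `|t|.
Proof. by rewrite /= expr0n addr0 sqrtr_sqr. Qed.

Lemma normc_le (R : rcfType) (x y : R) : cmod (x +i* y) <= `|x| + `|y|.
Proof.
have -> : x +i* y = x%:C + 'i * y%:C by rewrite [LHS]complexE.
rewrite (le_trans (le_normcD _ _))// Normc.normcM !normc_real.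
have -> : cmod ('i : R[i]) = 1 by rewrite /= expr0n expr1n add0r sqrtr1.
by rewrite mul1r.
Qed.

Lemma normrRe_le (R : rcfType) (z : R[i]) : `|complex.Re z| <= cmod z.
Proof. by have := normc_ge_Re z; rewrite lecR. Qed.

Lemma normrIm_le (R : rcfType) (z : R[i]) : `|complex.Im z| <= cmod z.
Proof.
case: z => x y /=; rewrite -sqrtr_sqr ler_sqrt ?addr_ge0 ?sqr_ge0//.
by rewrite lerDr sqr_ge0.
Qed.

Lemma normcX (R : rcfType) (z : R[i]) n : cmod (z ^+ n) = cmod z ^+ n.
Proof.
elim: n => [|n IH]; first by rewrite !expr0 Normc.normc1.
by rewrite !exprS Normc.normcM IH.
Qed.

Lemma root_opp1 (R : rcfType) k :
  exists2 w : R[i], w ^+ (2 ^ k) = -1 & cmod w = 1.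
Proof.
have [w hw] : exists w : R[i], w ^+ (2 ^ k) = -1.
  elim: k => [|k [w hw]]; first by exists (-1).
  exists (sqrtc w); by rewrite expnS exprM sqr_sqrtc.
exists w => //; apply/eqP.
rewrite -(@pexpr_eq1 _ _ (2 ^ k)) ?normc_ge0 ?expn_gt0//.
by rewrite -normcX hw normcN Normc.normc1.
Qed.

Lemma small_pow (R : realType) (t eps : R) :
  0 <= t -> t < 1 -> 0 < eps -> exists m, t ^+ m <= eps.
Proof.
move=> t0 t1 eps0; have : t ^+ n @[n --> \oo] --> 0.
  by apply: cvg_expr; rewrite ger0_norm.
move=> /cvgrPdist_le /(_ _ eps0)[m _ hm]; exists m.
by have := hm m (leqnn m); rewrite sub0r normrN ger0_norm ?exprn_ge0.
Qed.

(** * Algebra seminorms and the Gelfand-Mazur theorem *)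

Section Seminorms.
Variables (R : realType) (B : comPzRingType) (iota : {rmorphism R[i] -> B}).
Implicit Types (q : B -> R) (x y : B) (l : R[i]).

(** A quotient of [B] is handled through its norm pulled back to [B]: congruence of [x] and [y]
    reads [q (x - y) = 0], and no quotient ring is built. *)
Record alg_seminorm q : Prop := AlgSeminorm {
  seminormD : forall x y, q (x + y) <= q x + q y;
  seminormM : forall x y, q (x * y) <= q x * q y;
  seminormZ : forall l x, q (iota l * x) = cmod l * q x }.

Section Theory.
Variables (q : B -> R) (hq : alg_seminorm q).

Lemma seminorm0 : q 0 = 0.
Proof. by have := seminormZ hq 0 0; rewrite mulr0 Normc.normc0 mul0r. Qed.

Lemma seminormN x : q (- x) = q x.
Proof.
have := seminormZ hq (-1) x.
by rewrite rmorphN1 mulN1r normcN Normc.normc1 mul1r.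
Qed.

Lemma seminorm_ge0 x : 0 <= q x.
Proof.
have := seminormD hq x (- x); rewrite subrr seminorm0 seminormN; lra.
Qed.

Lemma seminormB x y : q (x - y) <= q x + q y.
Proof. by rewrite (le_trans (seminormD hq _ _))// seminormN. Qed.

Lemma seminormBC x y : q (x - y) = q (y - x).
Proof. by rewrite -seminormN opprB. Qed.

Lemma seminorm_tri x y : q x <= q (x - y) + q y.
Proof. by rewrite -{1}(subrK y x) seminormD. Qed.

Lemma seminormZ1 l : q (iota l) = cmod l * q 1.
Proof. by rewrite -seminormZ// mulr1. Qed.

Lemma kerD x y : q x = 0 -> q y = 0 -> q (x + y) = 0.
Proof.
by move=> x0 y0; have := seminormD hq x y; have := seminorm_ge0 (x + y); lra.
Qed.

Lemma kerB x y : q x = 0 -> q y = 0 -> q (x - y) = 0.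
Proof. by move=> x0 y0; rewrite kerD// seminormN. Qed.

Lemma kerMl x y : q y = 0 -> q (x * y) = 0.
Proof.
move=> y0; have := seminormM hq x y; have := seminorm_ge0 (x * y).
by rewrite y0; lra.
Qed.

Lemma kerMr x y : q x = 0 -> q (x * y) = 0.
Proof. by rewrite mulrC; exact: kerMl. Qed.

Lemma seminorm_congr x y : q (x - y) = 0 -> q x = q y.
Proof.
move=> xy; have := seminorm_tri x y; have := seminorm_tri y x.
by rewrite seminormBC xy; lra.
Qed.

Lemma seminormX x n : q (x ^+ n.+1) <= q x ^+ n.+1.
Proof.
elim: n => [|n IH]; first by rewrite !expr1.
rewrite exprS [leRHS]exprS (le_trans (seminormM hq _ _))//.
by rewrite ler_wpM2l// seminorm_ge0.
Qed.

End Theory.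

Record field_seminorm q : Prop := FieldSeminorm {
  field_seminorm_alg :> alg_seminorm q;
  field_seminorm1 : 0 < q 1;
  field_seminormV : forall x, q x != 0 -> exists y, q (x * y - 1) = 0 }.

(* If every a - l is invertible modulo the kernel of q and b = 1 / a, then the
   set E of radii r with r^n q(b^n) <= 1 for some n = 2 ^ k is stable under
   multiplication by a fixed factor 1 / t > 1, by equicontinuity in r of
   1 / (1 - (r b)^n); this contradicts r <= q a on E. *)
Section GelfandMazur.
Variables (q : B -> R) (hq : field_seminorm q) (a : B) (g : R[i] -> B).
Hypothesis gP : forall l, q ((a - iota l) * g l - 1) = 0.

(** This is the resolvent identity [g l - g m = (l - m) * g l * g m] modulo the kernel of [q]. *)
Let resolvent l m : q (g l - g m) <= cmod (l - m) * (q (g l) * q (g m)).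
Proof.
have -> : q (g l - g m) = q (iota (l - m) * (g l * g m)).
  apply: (seminorm_congr hq).
  have -> : g l - g m - iota (l - m) * (g l * g m) =
    g m * ((a - iota l) * g l - 1) - g l * ((a - iota m) * g m - 1) by ring.
  by apply: (kerB hq); exact: (kerMl hq).
rewrite (seminormZ hq) ler_wpM2l ?normc_ge0//; exact: (seminormM hq).
Qed.

Let resolvent_locally_bounded m l :
  cmod (l - m) * q (g m) <= 1 / 2 -> q (g l) <= 2 * q (g m).
Proof.
move=> lm; have := resolvent l m; have := seminorm_tri hq (g l) (g m).
have := seminorm_ge0 hq (g l).
set u := q (g l) in lm *; set v := q (g m) in lm *; set c := cmod _ in lm *.
move=> u0; nra.
Qed.

(** Local bounds are patched together by compactness of the square of side [[-r, r]], which contains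
    the disc of radius [r]. *)
Let resolvent_bounded (r : R) :
  exists2 G, 0 <= G & forall l, cmod l <= r -> q (g l) <= G.
Proof.
pose K := (`[-r, r] : set R) `*` (`[-r, r] : set R).
have cK : compact K by apply: compact_setX; exact: segment_compact.
move/compact_near_coveringP: cK.
move=> /(_ R +oo%R (fun i (z : R * R) => q (g (z.1 +i* z.2)) <= i) _) [].
  move=> [x y] _ /=; set c := q (g (x +i* y)).
  have c0 : 0 <= c by exact: (seminorm_ge0 hq).
  pose dl : R := (4 * (c + 1))^-1.
  have dl0 : 0 < dl by rewrite invr_gt0; lra.
  exists (ball (x, y) dl, [set i | 2 * c <= i]) => /=.
    split; first exact: nbhsx_ballx.
    by apply: nbhs_pinfty_ge; exact: num_real.
  move=> [[x' y'] i] /= [[hx hy] hi]; apply: le_trans hi.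
  apply: resolvent_locally_bounded; rewrite -/c.
  have -> : (x' +i* y') - (x +i* y) = (x' - x) +i* (y' - y) by [].
  have hn := normc_le (x' - x) (y' - y).
  move: hx hy; rewrite /ball/= => hx hy.
  rewrite distrC in hx; rewrite distrC in hy.
  have h2 : cmod ((x' - x) +i* (y' - y)) <= 2 * dl by lra.
  have : 2 * dl * c <= 1 / 2.
    rewrite /dl; have : (4 * (c + 1))^-1 * (4 * (c + 1)) = 1.
      by rewrite mulVf//; apply/eqP; lra.
    set e := (_)^-1 in dl0 *; nra.
  by apply: le_trans; rewrite ler_wpM2r.
move=> M [_ hM].
pose i := `|M| + 1; have iM : M < i by rewrite /i; have := ler_norm M; lra.
exists i; first by rewrite /i addr_ge0.
move=> [x y] lr; apply: (hM i iM (x, y)); split => /=; rewrite in_itv/= -ler_norml.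
- exact: le_trans (normrRe_le _) lr.
- exact: le_trans (normrIm_le _) lr.
Qed.


(* [h] represents a^n / (a^n - l^n) for n = 2 ^ k. *)
Let H k l h := q (h * (a ^+ (2 ^ k) - iota l ^+ (2 ^ k)) - a ^+ (2 ^ k)) = 0.

(* The constant does not depend on k, since a^2n / (a^2n - l^2n) is the mean of
   a^n / (a^n - l^n) and a^n / (a^n - (w * l)^n) where w^n = -1. *)
Let lipschitz (r : R) : 0 <= r -> exists2 L, 0 <= L &
  forall k l (t : R), cmod l <= r -> 0 <= t -> t <= 1 ->
  exists h h', [/\ H k l h, H k (t%:C * l) h' & q (h - h') <= L * (1 - t)].
Proof.
move=> r0; have [G G0 hG] := resolvent_bounded r.
have a0 := seminorm_ge0 hq a.
exists (q a * r * G ^+ 2); first by rewrite !mulr_ge0// exprn_ge0.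
elim=> [|k IH] l t lr t0 t1.
  exists (a * g l), (a * g (t%:C * l)); split.
  - rewrite /H expn0 !expr1 -(kerMl hq a (gP l)); congr q; ring.
  - rewrite /H expn0 !expr1 -(kerMl hq a (gP (t%:C * l))); congr q; ring.
  rewrite -mulrBr (le_trans (seminormM hq _ _))// -!mulrA ler_wpM2l//.
  rewrite (le_trans (resolvent _ _))//.
  have -> : l - t%:C * l = (1 - t)%:C * l by rewrite rmorphB/= rmorph1 mulrBl mul1r.
  rewrite Normc.normcM normc_real ger0_norm ?subr_ge0//.
  have tl : cmod (t%:C * l) <= r.
    rewrite Normc.normcM normc_real ger0_norm//.
    by rewrite (le_trans _ lr)// ler_piMl// normc_ge0.
  have -> : r * (G * (G * (1 - t))) = (1 - t) * r * (G * G) by ring.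
  have t1' : 0 <= 1 - t by rewrite subr_ge0.
  by rewrite !ler_pM ?mulr_ge0 ?normc_ge0 ?(seminorm_ge0 hq) ?hG.
have [w wN w1] := root_opp1 R k.
have wl : cmod (w * l) <= r by rewrite Normc.normcM w1 mul1r.
have [h1 [h1' [H1 H1' hh1]]] := IH l t lr t0 t1.
have [h2 [h2' [H2 H2' hh2]]] := IH (w * l) t wl t0 t1.
pose c := iota (2^-1 : R)%:C.
have c2 : c + c = 1.
  by rewrite -rmorphD/= -rmorphD/= -[2^-1]div1r -splitr !rmorph1.
have mean m u v : H k m u -> H k (w * m) v -> H k.+1 m (c * (u + v)).
  move=> Hu; rewrite /H rmorphM exprMn -[iota w ^+ _]rmorphXn wN.
  rewrite rmorphN1 mulN1r opprK => Hv.
  rewrite /H !expnSr !exprM; move: Hu Hv; rewrite /H.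
  set x := a ^+ _; set y := iota m ^+ _ => Hu Hv.
  have -> : c * (u + v) * (x ^+ 2 - y ^+ 2) - x ^+ 2 =
    c * ((u * (x - y) - x) * (x + y)) + c * ((v * (x + y) - x) * (x - y)).
    by rewrite -[X in _ - X]mul1r -c2; ring.
  by apply: (kerD hq); apply: (kerMl hq); exact: (kerMr hq).
exists (c * (h1 + h2)), (c * (h1' + h2')); split.
- exact: mean.
- by apply: mean => //; rewrite mulrCA.
- rewrite -mulrBr (seminormZ hq) normc_real ger0_norm ?invr_ge0//.
  have -> : h1 + h2 - (h1' + h2') = (h1 - h1') + (h2 - h2') by ring.
  by have := seminormD hq (h1 - h1') (h2 - h2'); lra.
Qed.

Let b := g 0.

Let abX n : q (a ^+ n * b ^+ n - 1) = 0.
Proof.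
rewrite -exprMn subrX1; apply: (kerMr hq).
by rewrite -(gP 0) rmorph0 subr0.
Qed.

Let E (r : R) := exists k, r ^+ (2 ^ k) * q (b ^+ (2 ^ k)) <= 1.

Let E_mono r k j : 0 <= r -> (k <= j)%N ->
  r ^+ (2 ^ k) * q (b ^+ (2 ^ k)) <= 1 -> r ^+ (2 ^ j) * q (b ^+ (2 ^ j)) <= 1.
Proof.
move=> r0 /subnKC <-; elim: (j - k)%N => [|i IH]; first by rewrite addn0.
move=> /IH {}IH; rewrite addnS expnSr !exprM.
have := seminormM hq (b ^+ (2 ^ (k + i))) (b ^+ (2 ^ (k + i))).
have := seminorm_ge0 hq (b ^+ (2 ^ (k + i))).
have : 0 <= r ^+ (2 ^ (k + i)) by rewrite exprn_ge0.
rewrite -!expr2; move: IH; set x := r ^+ _; set y := q (b ^+ _).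
move=> xy x0 y0 yy; apply: (le_trans (y := x ^+ 2 * y ^+ 2)).
  by rewrite ler_wpM2l// exprn_ge0.
by rewrite -exprMn expr_le1// mulr_ge0.
Qed.

Let q1_ge1 : 1 <= q 1.
Proof.
have := seminormM hq 1 1; have := field_seminorm1 hq.
by rewrite mul1r; nra.
Qed.

(** Modulo the kernel [a ^ n] inverts [b ^ n], so [1 <= q 1 <= q a ^ n * q (b ^ n)]; multiply by
    [r ^ n]. *)
Let E_bound r : 0 <= r -> E r -> r <= q a.
Proof.
move=> r0 [k]; have n0 : (0 < 2 ^ k)%N by rewrite expn_gt0.
move: (2 ^ k)%N n0 => n n0 hn.
rewrite -(@ler_pXn2r _ n)// ?nnegrE ?(seminorm_ge0 hq)//.
have : q 1 <= q a ^+ n * q (b ^+ n).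
  rewrite -(seminorm_congr hq (abX n)) (le_trans (seminormM hq _ _))//.
  rewrite ler_wpM2r ?(seminorm_ge0 hq)//.
  by case: n n0 {hn} => // n _; exact: (seminormX hq).
have : 0 <= r ^+ n by rewrite exprn_ge0.
have : 0 <= q a ^+ n by rewrite exprn_ge0// (seminorm_ge0 hq).
have := q1_ge1; have := seminorm_ge0 hq (b ^+ n).
move: hn; set x := r ^+ n; set y := q (b ^+ n); set z := q a ^+ n.
move=> xy y0 h1 z0 x0 h2.
have : x * 1 <= x * (z * y) by rewrite ler_wpM2l// (le_trans h1).
rewrite mulr1 => /le_trans; apply; rewrite mulrCA ler_piMr//.
Qed.

(** Modulo the kernel, [h] is [1 / (1 - (l * b) ^ n)]. At [l = t * r] the power has seminorm at most
    1/8, so [h'] is near 1. Equicontinuity carries this to [l = r / t], where [h] within 1/2 of 1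
    makes the power at most 1. *)
Let E_step : exists t : R, [/\ 0 < t, t < 1 &
  forall r, 0 <= r -> E r -> E (r / t)].
Proof.
have qa0 := seminorm_ge0 hq a.
have [L L0 lip] := @lipschitz (2 * q a) (mulr_ge0 (ler0n R 2) qa0).
(* This size gives [L * (1 - t ^ 2) <= 2 * L * s <= 1 / 6] and keeps [r / t] at most [2 * q a]. *)
pose s := (12 * (L + 1))^-1.
have s0 : 0 < s by rewrite invr_gt0; lra.
have sL : 12 * (L * s) + 12 * s = 1.
  have : s * (12 * (L + 1)) = 1 by rewrite mulVf//; apply/eqP; lra.
  lra.
have Ls0 : 0 <= L * s by rewrite mulr_ge0// ltW.
pose t := 1 - s; have t0 : 0 < t by rewrite /t; lra.
have t1 : t < 1 by rewrite /t; lra.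
exists t; split => // r r0 Er.
have ra := E_bound r0 Er; case: Er => k0 hk0.
have e8 : 0 < 8^-1 :> R by rewrite invr_gt0.
have [m tm] := small_pow (ltW t0) t1 e8.
pose k := maxn k0 m; pose n := (2 ^ k)%N.
have hk : r ^+ n * q (b ^+ n) <= 1 by apply: E_mono hk0; rewrite ?leq_maxl.
have tn : t ^+ n <= 8^-1.
  apply: le_trans tm; rewrite ler_wiXn2l ?ltW//.
  apply: leq_trans (leq_maxr k0 m) _; exact/ltnW/ltn_expl.
have rt0 : 0 <= r / t by rewrite divr_ge0// ltW.
have rtr : cmod (r / t)%:C <= 2 * q a.
  rewrite normc_real ger0_norm// ler_pdivrMr//; rewrite /t; nra.
have [||h [h' [Hh Hh' hh]]] := lip k (r / t)%:C (t ^+ 2) rtr.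
- by rewrite exprn_ge0// ltW.
- by rewrite expr_le1// ltW.
have inv l u : H k l u -> q (u * (1 - iota l ^+ n * b ^+ n) - 1) = 0.
  rewrite /H -/n => Hu.
  have -> : u * (1 - iota l ^+ n * b ^+ n) - 1 =
    (u * (a ^+ n - iota l ^+ n) - a ^+ n) * b ^+ n
    - (u - 1) * (a ^+ n * b ^+ n - 1) by ring.
  by apply: (kerB hq); [exact: (kerMr hq)|exact/(kerMl hq)/abX].
have qX (v : R) : 0 <= v -> q (iota v%:C ^+ n * b ^+ n) = v ^+ n * q (b ^+ n).
  by move=> v0; rewrite -rmorphXn (seminormZ hq) normcX normc_real ger0_norm.
have h'1 : q (h' - 1) <= 1 / 4.
  have := inv _ _ Hh'; set y := _ * b ^+ n => hy.
  have qy : q y <= 1 / 8.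
    have -> : y = iota (t * r)%:C ^+ n * b ^+ n.
      rewrite /y -rmorphM/=; congr (iota _%:C ^+ n * _).
      by field; rewrite gt_eqF.
    rewrite qX; last by rewrite mulr_ge0 ?(ltW t0).
    rewrite exprMn -mulrA.
    by rewrite div1r (le_trans _ tn)// ler_piMr// exprn_ge0// ltW.
  have e : q (h' - 1) = q ((h' - 1) * y + y).
    by apply: (seminorm_congr hq); rewrite -hy; congr q; ring.
  have := seminormD hq ((h' - 1) * y) y; rewrite -e.
  have := seminormM hq (h' - 1) y; have := seminorm_ge0 hq (h' - 1).
  have := seminorm_ge0 hq y; nra.
have h1 : q (h - 1) <= 1 / 2.
  have -> : h - 1 = (h - h') + (h' - 1) by ring.
  rewrite (le_trans (seminormD hq _ _))//.
  have : L * (1 - t ^+ 2) <= 1 / 6 by rewrite /t; nra.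
  lra.
exists k; rewrite -/n -qX//; have := inv _ _ Hh; set x := _ * b ^+ n => hx.
have e : q x = q ((h - 1) - (h - 1) * x).
  rewrite (seminormBC hq) -[x in LHS]opprK (seminormN hq).
  apply: (seminorm_congr hq); rewrite -hx; congr q; ring.
have := seminormB hq (h - 1) ((h - 1) * x); rewrite -e.
have := seminormM hq (h - 1) x; have := seminorm_ge0 hq (h - 1).
have := seminorm_ge0 hq x; nra.
Qed.

Lemma not_everywhere_resolvent : False.
Proof.
have [t [t0 t1 tE]] := E_step.
have qa0 := seminorm_ge0 hq a; have qb0 := seminorm_ge0 hq b.
pose r := (q b + 1)^-1; have r0 : 0 < r by rewrite invr_gt0; lra.
have Et m : E (r / t ^+ m).
  elim: m => [|m IH].
    exists 0%N; rewrite expn0 !expr1 expr0 divr1.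
    by rewrite mulrC ler_pdivrMr; lra.
  rewrite exprSr invfM mulrA; apply: tE => //.
  by rewrite divr_ge0 ?exprn_ge0// ltW.
have rr : 0 < r / (2 * (q a + 1)) by rewrite divr_gt0//; lra.
(* For this [m], [r / t ^ m] is at least [2 * (q a + 1)], beyond the bound [q a] on [E]. *)
have [m] := small_pow (ltW t0) t1 rr.
rewrite ler_pdivlMr; last lra.
have rt : 0 <= r / t ^+ m by rewrite divr_ge0 ?exprn_ge0// ltW.
have := E_bound rt (Et m).
rewrite ler_pdivrMr ?exprn_gt0//; nra.
Qed.

End GelfandMazur.

Theorem gelfand_mazur q : field_seminorm q ->
  forall a, exists l, q (a - iota l) = 0.
Proof.
move=> hq a; apply: contrapT => /forallNP na.
have /choice[g gP] l : exists y, q ((a - iota l) * y - 1) = 0.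
  by apply: (field_seminormV hq); apply/eqP; exact: na.
exact: (not_everywhere_resolvent hq gP).
Qed.

End Seminorms.

(** Stands in for passing to the limit in the norm estimates below. *)
Lemma le_geometric (R : realType) (x y c : R) :
  (forall n, x <= y + c * 2^-1 ^+ n) -> x <= y.
Proof.
move=> h; rewrite leNgt; apply/negP => yx.
have c0 : 0 < c by have := h 0%N; rewrite expr0; lra.
have [|||n] := @small_pow R 2^-1 ((x - y) / (2 * c)); [lra|lra| |].
  by rewrite divr_gt0 ?mulr_gt0//; lra.
rewrite ler_pdivlMr; last lra.
by have := h n; lra.
Qed.

(** * Complete norms, Baire category and the closed graph theorem *)

Section BanachAlgebra.
Variables (R : realType) (B : comPzRingType) (iota : {rmorphism R[i] -> B}).
Implicit Types (q : B -> R) (x y : B) (l : R[i]).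

(** Completeness is stated for series dominated by [2^-1 ^ n], with an explicit tail bound, so that
    [B] needs no topology. *)
Record banach_norm (N : B -> R) : Prop := BanachNorm {
  banach_norm_alg :> alg_seminorm iota N;
  banach_norm_eq0 : forall x, N x = 0 -> x = 0;
  banach_norm_complete : forall u : nat -> B,
    (forall n, N (u n) <= 2^-1 ^+ n) ->
    exists x, forall n, N (x - \sum_(i < n) u i) <= 2 * 2^-1 ^+ n }.

Variables (N : B -> R) (hN : banach_norm N).

Let N0 := seminorm_ge0 hN.

Lemma normZ_real (c : R) x : 0 <= c -> N (iota c%:C * x) = c * N x.
Proof. by move=> c0; rewrite (seminormZ hN) normc_real ger0_norm. Qed.

Lemma scaler_realK (c : R) x : c != 0 -> iota c%:C * (iota c^-1%:C * x) = x.
Proof.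
by move=> c0; rewrite mulrA -rmorphM/= -rmorphM mulfV// !rmorph1 mul1r.
Qed.

Lemma complete_scaled (c : R) (u : nat -> B) : 0 < c ->
  (forall n, N (u n) <= c * 2^-1 ^+ n) ->
  exists x, forall n, N (x - \sum_(i < n) u i) <= 2 * c * 2^-1 ^+ n.
Proof.
move=> c0 hu; have ci0 : 0 <= c^-1 by rewrite invr_ge0 ltW.
have [n|x hx] := @banach_norm_complete N hN (fun n => iota c^-1%:C * u n).
  by rewrite normZ_real// mulrC ler_pdivrMr// mulrC.
exists (iota c%:C * x) => n.
have -> : \sum_(i < n) u i = iota c%:C * \sum_(i < n) (iota c^-1%:C * u i).
  by rewrite -mulr_sumr scaler_realK ?gt_eqF.
rewrite -mulrBr normZ_real ?(ltW c0)// [2 * c]mulrC -mulrA.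
by rewrite ler_wpM2l ?(ltW c0).
Qed.

(** If no [V n] were dense in a ball, shrinking balls avoiding each [V n] in turn would close in on
    a point outside all of them. *)
Lemma complete_baire (V : nat -> B -> Prop) : (forall x, exists n, V n x) ->
  exists n x0 (r : R), 0 < r /\ forall y, N (y - x0) <= r ->
  forall eps, 0 < eps -> exists z, V n z /\ N (y - z) < eps.
Proof.
move=> cover; apply: contrapT => hV.
have step n (z : B * R) : exists z' : B * R, 0 < z.2 ->
  [/\ N (z'.1 - z.1) <= z.2 / 4, 0 < z'.2, z'.2 <= z.2 / 4 &
    forall v, N (v - z'.1) <= z'.2 -> ~ V n v].
  have [r0|r0] := ltP 0 z.2; last by exists z.
  apply: contrapT => h; apply: hV; exists n, z.1, (z.2 / 4).
  split=> [|y yx eps eps0]; first by rewrite divr_gt0.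
  apply: contrapT => hz; apply: h.
  exists (y, Num.min (eps / 2) (z.2 / 4)) => _ /=.
  rewrite lt_min ge_min lexx orbT !divr_gt0//; split=> // v.
  rewrite le_min => /andP[vy _] Vv; apply: hz; exists v; split => //.
  by rewrite (seminormBC hN); lra.
have [f fP] := choice (fun nz : nat * (B * R) => step nz.1 nz.2).
pose s := fix s n := if n is m.+1 then f (m, s m) else (0 : B, 1 : R).
have s0 n : 0 < (s n).2.
  elim: n => [|n IH] /=; first exact: ltr01.
  by have [] := fP (n, s n) IH.
have sP n : [/\ N ((s n.+1).1 - (s n).1) <= (s n).2 / 4,
    (s n.+1).2 <= (s n).2 / 4 &
    forall v, N (v - (s n.+1).1) <= (s n.+1).2 -> ~ V n v].
  by have [] := fP (n, s n) (s0 n).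
have s2 n : (s n).2 <= 2^-1 ^+ n.
  elim: n => [|n IH] //; rewrite exprS.
  by have [_ h _] := sP n; have := s0 n; lra.
have [|x hx] := @banach_norm_complete N hN (fun n => (s n.+1).1 - (s n).1).
  by move=> n; have [h _ _] := sP n; have := s2 n; have := s0 n; lra.
have tele n : \sum_(i < n) ((s i.+1).1 - (s i).1) = (s n).1.
  elim: n => [|n IH]; first by rewrite big_ord0.
  by rewrite big_ord_recr/= IH addrC subrK.
(* The radii absorb the moves of the centres, so the limit stays in every ball. *)
have near n m : N ((s (n + m)%N).1 - (s n).1) <= (s n).2 - (s (n + m)%N).2.
  elim: m => [|m IH]; first by rewrite addn0 !subrr (seminorm0 hN).
  rewrite addnS; have [h1 h2 _] := sP (n + m)%N; have h3 := s0 (n + m)%N.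
  have := seminormD hN ((s (n + m).+1).1 - (s (n + m)%N).1)
    ((s (n + m)%N).1 - (s n).1).
  by rewrite addrA subrK; lra.
have [n] := cover x; have [_ _] := sP n; apply.
apply: (@le_geometric _ _ _ 2) => m.
have := near n.+1 m; have := hx (n.+1 + m)%N; rewrite tele => h1 h2.
have := seminormD hN (x - (s (n.+1 + m)%N).1) ((s (n.+1 + m)%N).1 - (s n.+1).1).
rewrite addrA subrK; have := s0 (n.+1 + m)%N.
have : (2^-1 : R) ^+ (n.+1 + m) <= 2^-1 ^+ m.
  by rewrite ler_wiXn2l ?leq_addl//; lra.
lra.
Qed.

Definition separating (D : B -> B) s :=
  forall eps, 0 < eps -> exists x, N x <= eps /\ N (D x - s) <= eps.

(** By Baire, some set [N (D x) <= n] is dense in a ball, so each [y] is approximated up to half its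
    norm by some [z] with [N (D z) <= C * N y]. Iterating on the error writes [x] as a series whose
    images sum to some [w]; then [D x - w] is separating, hence zero. *)
Lemma closed_graph (D : {additive B -> B}) :
  (forall l x, D (iota l * x) = iota l * D x) ->
  (forall s, separating D s -> s = 0) ->
  exists2 C, 0 <= C & forall x, N (D x) <= C * N x.
Proof.
move=> DZ sep0.
have [|n [x0 [r [r0 dense]]]] := @complete_baire (fun n x => N (D x) <= n%:R).
  by move=> x; exists (Num.truncn (N (D x))).+1; exact/ltW/truncnS_gt.
pose C : R := 2 * n%:R / r.
have C0 : 0 <= C by rewrite divr_ge0 ?mulr_ge0// ltW.
have approx y : exists z, N (D z) <= C * N y /\ N (y - z) <= N y / 2.
  have [y0|ny] := eqVneq (N y) 0.
    exists 0; rewrite raddf0 (seminorm0 hN) subr0 y0.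
    by rewrite mulr0 mul0r.
  have Ny : 0 < N y by rewrite lt_neqAle eq_sym ny N0.
  pose c := r / N y; have c0 : 0 < c by rewrite divr_gt0.
  have eps0 : 0 < c * N y / 4 by rewrite divr_gt0// mulr_gt0.
  have [|z1 [Dz1 yz1]] := dense (x0 + iota c%:C * y) _ _ eps0.
    by rewrite addrC addKr normZ_real ?(ltW c0)// /c divfK.
  have [|z2 [Dz2 yz2]] := dense x0 _ _ eps0.
    by rewrite subrr (seminorm0 hN) ltW.
  have ci0 : 0 <= c^-1 by rewrite invr_ge0 ltW.
  exists (iota c^-1%:C * (z1 - z2)); split.
    rewrite DZ normZ_real// mulrC ler_pdivrMr// raddfB/=.
    have -> : C * N y * c = 2 * n%:R by rewrite /C /c; field; rewrite ny gt_eqF.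
    by have := seminormB hN (D z1) (D z2); lra.
  have -> : y - iota c^-1%:C * (z1 - z2) =
      iota c^-1%:C * ((x0 + iota c%:C * y - z1) - (x0 - z2)).
    have e : iota c^-1%:C * (iota c%:C * y) = y.
      by rewrite mulrCA scaler_realK// gt_eqF.
    by rewrite -{1}e; ring.
  rewrite normZ_real// mulrC ler_pdivrMr//.
  have := seminormB hN (x0 + iota c%:C * y - z1) (x0 - z2); lra.
have [f fP] := choice approx.
exists (2 * (C + 1)); first lra.
move=> x; have [x0'|nx] := eqVneq (N x) 0.
  by rewrite (banach_norm_eq0 hN x0') raddf0 (seminorm0 hN) mulr0.
have Nx : 0 < N x by rewrite lt_neqAle eq_sym nx N0.
pose y k := iter k (fun v => v - f v) x.
have y2 k : N (y k) <= N x * 2^-1 ^+ k.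
  elim: k => [|k IH]; first by rewrite expr0 mulr1.
  by have [_] := fP (y k); rewrite exprS /=; lra.
have [||w hw] := @complete_scaled ((C + 1) * N x) (fun k => D (f (y k))).
- by rewrite mulr_gt0//; lra.
- move=> k; have [h _] := fP (y k); rewrite (le_trans h)// -mulrA.
  by rewrite (le_trans (ler_wpM2l C0 (y2 k)))// ler_wpM2r ?lerDl//
    (le_trans _ (y2 k)).
have yw k : D (y k) = D x - \sum_(i < k) D (f (y i)).
  elim: k => [|k IH]; first by rewrite big_ord0 subr0.
  by rewrite big_ord_recr opprD addrA -IH /= raddfB.
suff /subr0_eq -> : D x - w = 0.
  by have := hw 0%N; rewrite big_ord0 subr0 expr0 mulr1 mulrA.
apply: sep0 => eps eps0.
pose K := 2 * ((C + 1) * N x) + N x.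
have K0 : 0 < K by rewrite /K; nra.
have [|||m hm] := @small_pow R 2^-1 (eps / K); [lra|lra|exact: divr_gt0|].
have p0 : 0 <= (2^-1 : R) ^+ m by rewrite exprn_ge0//; lra.
move: hm; rewrite ler_pdivlMr// => hm.
have Cx : 0 <= (C + 1) * N x by rewrite mulr_ge0//; lra.
(* The remainder [y m] tends to 0 while [D (y m)] tends to [D x - w]. *)
exists (y m); split.
  by rewrite (le_trans (y2 m))//; rewrite /K in hm; nra.
have -> : D (y m) - (D x - w) = w - \sum_(i < m) D (f (y i)).
  by rewrite yw; ring.
by rewrite (le_trans (hw m))//; rewrite /K in hm; nra.
Qed.

(** * Bounded derivations: the Singer-Wermer argument *)

Section Derivation.
Variables (D : {additive B -> B}).
Hypotheses (DM : forall x y, D (x * y) = D x * y + x * D y)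
  (DC : forall l, D (iota l) = 0).

Let DZ l x : D (iota l * x) = iota l * D x.
Proof. by rewrite DM DC mul0r add0r. Qed.

(** The kernel of [q] need not be stable under [D]. Quantifying over [y] lets the induction absorb
    one derivative as [a ^ n * (n.+1 * D a * y + a * D y)]; the term with the extra factor [a] dies
    under [q] at the end. *)
Lemma iter_derivation_pow q a y n : alg_seminorm iota q -> q a = 0 ->
  q (iter n D (a ^+ n * y) - n`!%:R * (D a) ^+ n * y) = 0.
Proof.
move=> hq qa; elim: n y => [|n IH] y.
  by rewrite /= !expr0 !mul1r subrr (seminorm0 hq).
have DX m : D (a ^+ m.+1) = m.+1%:R * a ^+ m * D a.
  elim: m => [|m IHm]; first by rewrite expr0 !mulr1 mul1r expr1.
  rewrite exprS DM IHm [m.+2%:R]mulrSr. rewrite exprS; ring.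
have -> : iter n.+1 D (a ^+ n.+1 * y) =
    iter n D (a ^+ n * (n.+1%:R * D a * y + a * D y)).
  rewrite iterSr; congr (iter n D _).
  by rewrite DM DX exprS; ring.
rewrite -(kerD hq (IH (n.+1%:R * D a * y + a * D y))
  (kerMr hq (n`!%:R * (D a) ^+ n * D y) qa)).
by congr q; rewrite factS natrM exprS; ring.
Qed.

(** If [t > 0], the terms [(K / t) ^ n / n!] of the exponential series tend to 0, so one of them is
    at most [1 / (2 * M)]. *)
Lemma fact_dominates (t K M : R) : 0 <= t ->
  (forall n, n`!%:R * t ^+ n <= M * K ^+ n) -> t = 0.
Proof.
rewrite le0r => /orP[/eqP//|t0] h.
have := h 0%N; rewrite fact0 !expr0 !mulr1 => M1.
have M0 : 0 < M by rewrite (lt_le_trans _ M1).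
have : exp_coeff (K / t) n @[n --> \oo] --> 0.
  exact/cvg_series_cvg_0/is_cvg_series_exp_coeff.
have Mi : 0 < (2 * M)^-1 by rewrite invr_gt0 mulr_gt0.
move=> /cvgrPdist_le /(_ _ Mi)[n _ /(_ n (leqnn n))].
rewrite sub0r normrN /exp_coeff/= => /ler_normlW.
have n0 : 0 < n`!%:R :> R by rewrite ltr0n fact_gt0.
rewrite ler_pdivrMr// expr_div_n ler_pdivrMr ?exprn_gt0// -mulrA.
rewrite mulrC ler_pdivlMr ?mulr_gt0//.
have := h n; have : 0 < n`!%:R * t ^+ n by rewrite mulr_gt0// exprn_gt0.
nra.
Qed.

(* If a lies in the kernel of q and D a is congruent to the scalar m, then
   D^n (a^n) is congruent to n! m^n, while its norm is at most |D|^n |a|^n. *)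
Lemma bounded_derivation_ker (C : R) q : 0 <= C ->
  (forall x, N (D x) <= C * N x) ->
  field_seminorm iota q -> (forall x, q x <= N x) -> forall a, q (D a) = 0.
Proof.
move=> C0 DN hq qN a0.
(* Subtracting a scalar moves the element into the kernel of [q] and keeps its derivative. *)
have [l al] := gelfand_mazur hq a0; set a := a0 - iota l in al.
have -> : D a0 = D a by rewrite /a raddfB/= DC subr0.
have [m am] := gelfand_mazur hq (D a).
suff m0 : cmod m = 0 by rewrite (seminorm_congr hq am) (seminormZ1 hq) m0 mul0r.
have q1 := field_seminorm1 hq.
apply: (@fact_dominates _ (C * N a) (N 1 / q 1)); first exact: normc_ge0.
move=> n; rewrite mulrAC ler_pdivlMr//.
have -> : n`!%:R * cmod m ^+ n * q 1 = q (iter n D (a ^+ n * 1)).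
  rewrite (seminorm_congr hq (iter_derivation_pow 1 n hq al)).
  rewrite [RHS](@seminorm_congr _ _ _ _ hq _ (iota (n`!%:R%:C * m ^+ n))).
    rewrite (seminormZ1 hq) Normc.normcM normcX normc_real ger0_norm//.
  rewrite rmorphM/= !rmorph_nat mulr1 -mulrBr rmorphXn subrXX.
  by apply: (kerMl hq); exact: (kerMr hq).
rewrite (le_trans (qN _))// (le_trans (y := C ^+ n * N (a ^+ n * 1)))//.
  elim: n (a ^+ n * 1) => [|n IH] x; first by rewrite mul1r.
  by rewrite iterS (le_trans (DN _))// exprS -mulrA ler_wpM2l.
rewrite exprMn mulrCA ler_wpM2l ?exprn_ge0//.
elim: n => [|n IH]; first by rewrite !expr0 !mulr1.
rewrite exprS -mulrA (le_trans (seminormM hN _ _))// [N a ^+ _]exprS.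
by rewrite mulrCA ler_wpM2l.
Qed.

End Derivation.
End BanachAlgebra.

(** * Automatic continuity and vanishing of derivations in the semisimple case *)

Section SemisimpleDerivation.
Variables (R : realType) (B : comPzRingType) (iota : {rmorphism R[i] -> B}).
Variables (N : B -> R) (hN : banach_norm iota N).
Implicit Types (q : B -> R) (x y : B) (l : R[i]).

Let N0 := seminorm_ge0 hN.

(* A field seminorm below N is the quotient norm modulo a maximal ideal. *)
Definition primitive_seminorm q :=
  field_seminorm iota q /\ forall x, q x <= N x.

Hypothesis semisimple :
  forall x, x != 0 -> exists2 q, primitive_seminorm q & 0 < q x.

Lemma semisimple_reduced x : x ^+ 2 = 0 -> x = 0.
Proof.
move=> x2; apply/eqP/negPn/negP => /semisimple[q [hq _] qx].
have [|y hy] := field_seminormV hq (x := x); first by rewrite gt_eqF.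
have e : q (1 * 1) = q (x ^+ 2 * y ^+ 2).
  apply: (seminorm_congr hq).
  rewrite -(kerMr hq (- (1 + x * y)) hy); congr q; ring.
have := field_seminorm1 hq.
by rewrite -[1]mulr1 e x2 mul0r (seminorm0 hq) ltxx.
Qed.

(** [Y k] is the sum over [j] of [c k * ... * c (k + j - 1) * y (k + j)]. In the gliding hump, the
    tail after stage [k] must be a multiple of [c k]. *)
Lemma telescoping_series (c y : nat -> B) :
  (forall k, N (c k) <= 1) -> (forall k, N (y k) <= 2^-1 ^+ k) ->
  exists Y : nat -> B, forall k, Y k = y k + c k * Y k.+1.
Proof.
move=> c1 y2.
pose u k j := (\prod_(i < j) c (k + i)%N) * y (k + j)%N.
have prodN k j z : N ((\prod_(i < j) c (k + i)%N) * z) <= N z.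
  elim: j z => [|j IH] z; first by rewrite big_ord0 mul1r.
  rewrite big_ord_recr/= -mulrA (le_trans (IH _))//.
  by rewrite (le_trans (seminormM hN _ _))// ler_piMl.
have uN k j : N (u k j) <= 2^-1 ^+ j.
  rewrite (le_trans (prodN _ _ _))// (le_trans (y2 _))//.
  by rewrite ler_wiXn2l ?leq_addl//; lra.
have /choice[Y hY] k := banach_norm_complete hN (uN k).
exists Y => k; apply/subr0_eq/(banach_norm_eq0 hN)/eqP.
rewrite eq_le N0 andbT; apply: (@le_geometric _ _ _ 4) => n; rewrite add0r.
have S : \sum_(i < n.+1) u k i = y k + c k * \sum_(i < n) u k.+1 i.
  rewrite big_ord_recl {1}/u big_ord0 mul1r addn0 mulr_sumr.
  congr (_ + _); apply: eq_bigr => i _.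
  rewrite /u /= /bump/= add1n big_ord_recl/= addn0 mulrA addnS addSn.
  congr (_ * _ * _); apply: eq_bigr => j _.
  by rewrite /bump/= add1n addnS addSn.
have -> : Y k - (y k + c k * Y k.+1) = (Y k - \sum_(i < n.+1) u k i)
    - c k * (Y k.+1 - \sum_(i < n) u k.+1 i) by rewrite S; ring.
have h1 := hY k n.+1; have h2 := hY k.+1 n; rewrite exprS in h1.
have h3 := seminormM hN (c k) (Y k.+1 - \sum_(i < n) u k.+1 i).
have h4 : N (c k) * N (Y k.+1 - \sum_(i < n) u k.+1 i) <=
    N (Y k.+1 - \sum_(i < n) u k.+1 i) by rewrite ler_piMl.
have p0 : 0 <= (2^-1 : R) ^+ n by rewrite exprn_ge0//; lra.
by rewrite (le_trans (seminormB hN _ _))//; lra.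
Qed.

Variable D : {additive B -> B}.
Hypotheses (DM : forall x y, D (x * y) = D x * y + x * D y)
  (DC : forall l, D (iota l) = 0).

Let DZ l x : D (iota l * x) = iota l * D x.
Proof. by rewrite DM DC mul0r add0r. Qed.

(** Multiplying [D p = 2 * p * D p] by [p] gives [p * D p = 0]. *)
Lemma derivation_idempotent p : p * p = p -> D p = 0.
Proof.
move=> pp; have e := DM p p; rewrite pp in e.
have pDp : p * D p = 0.
  have : p * D p = p * (D p * p + p * D p) by rewrite -e.
  have -> : p * (D p * p + p * D p) = p * p * D p + p * p * D p by ring.
  by rewrite pp -{1}[p * D p]add0r => /addIr.
by rewrite e mulrC pDp addr0.
Qed.

Lemma separatingM v s : separating N D s -> separating N D (v * s).
Proof.
move=> hs eps eps0; pose K := N v + N (D v) + 1.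
have v0 := N0 v; have Dv0 := N0 (D v).
have K0 : 0 < K by rewrite /K; lra.
have [x [hx Dx]] := hs (eps / K) (divr_gt0 eps0 K0).
have e0 : 0 <= eps / K by rewrite divr_ge0// ltW.
have eK : eps / K * K = eps by rewrite divfK// gt_eqF.
have M1 : N v * N x <= N v * (eps / K) by rewrite ler_wpM2l.
have M2 : N (D v) * N x <= N (D v) * (eps / K) by rewrite ler_wpM2l.
have M3 : N v * N (D x - s) <= N v * (eps / K) by rewrite ler_wpM2l.
exists (v * x); split.
  rewrite (le_trans (seminormM hN _ _))// (le_trans M1)//.
  by rewrite -[leRHS]eK mulrC ler_wpM2l// /K; lra.
have -> : D (v * x) - v * s = D v * x + v * (D x - s) by rewrite DM; ring.
have := seminormD hN (D v * x) (v * (D x - s)).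
have := seminormM hN (D v) x; have := seminormM hN v (D x - s).
move: eK; rewrite /K; set f := eps / K in e0 M1 M2 M3 *; nra.
Qed.

(** For a small [x] supplied by [s], [D (v * x)] is close to [v * s]; [y] is such an [x] times a
    large scalar [c]. *)
Lemma separating_hump s q v (L eta : R) :
  separating N D s -> primitive_seminorm q -> 0 < q (v * s) ->
  0 < eta -> exists y, N y <= eta /\ L <= q (D (v * y)).
Proof.
move=> hs [hq qN] qvs eta0.
have q0 := seminorm_ge0 hq.
pose c := (`|L| + 1) / q (v * s).
have c0 : 0 < c by rewrite divr_gt0// ltr_wpDl.
pose K := N v + N (D v) + 1.
have v0 := N0 v; have Dv0 := N0 (D v).
have K0 : 0 < K by rewrite /K; lra.
(* The first bound keeps [N y] at most [eta], the second keeps the error [c * eps * K] at most 1. *)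
pose eps := Num.min (eta / c) (1 / (c * K)).
have eps0 : 0 < eps.
  by rewrite lt_min (divr_gt0 eta0 c0) (divr_gt0 ltr01 (mulr_gt0 c0 K0)).
have [x [hx Dx]] := hs eps eps0.
have ceta : c * eps <= eta.
  by rewrite mulrC -ler_pdivlMr// ge_min lexx.
have cK : c * eps * K <= 1.
  by rewrite mulrAC mulrC -(ler_pdivlMr _ _ (mulr_gt0 c0 K0)) ge_min lexx orbT.
exists (iota c%:C * x); split.
  rewrite (normZ_real hN) ?(ltW c0)// (le_trans _ ceta)//.
  by rewrite ler_wpM2l ?(ltW c0).
rewrite mulrCA DZ (seminormZ hq) normc_real ger0_norm ?(ltW c0)//.
have h : q (v * s) - eps * K <= q (D (v * x)).
  have e : v * s = D (v * x) - (D v * x + v * (D x - s)) by rewrite DM; ring.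
  have := seminormB hq (D (v * x)) (D v * x + v * (D x - s)); rewrite -e.
  have := seminormD hq (D v * x) (v * (D x - s)).
  have := qN (D v * x); have := qN (v * (D x - s)).
  have := seminormM hN (D v) x; have := seminormM hN v (D x - s).
  have : N v * N (D x - s) <= N v * eps by rewrite ler_wpM2l.
  have : N (D v) * N x <= N (D v) * eps by rewrite ler_wpM2l.
  by rewrite /K; lra.
apply: (le_trans (y := c * (q (v * s) - eps * K))); last first.
  by rewrite ler_wpM2l ?(ltW c0).
have -> : c * (q (v * s) - eps * K) = `|L| + 1 - c * eps * K.
  by rewrite mulrBr /c divfK ?gt_eqF// !mulrA.
by have := ler_norm L; lra.
Qed.

(* If every q with q t > 0 had a kernel annihilating t, then t would generate a
   minimal ideal p B = C p with p idempotent, so that D p = 0 and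
   p (D a) = D (p a) = 0, whence t = p t = 0. *)
Lemma separating_not_minimal t : separating N D t -> t != 0 ->
  exists q w, [/\ primitive_seminorm q, 0 < q t, q w = 0, N w <= 1 & w * t != 0].
Proof.
move=> ht t0; have [q [hq qN] qt] := semisimple t0.
apply: contrapT => hno.
(* A [w] in the kernel with [w * t != 0] could be rescaled to norm at most 1, against [hno]. *)
have ann w : q w = 0 -> w * t = 0.
  move=> qw; apply/eqP/negPn/negP => wt; apply: hno.
  pose c := (N w + 1)^-1; have c0 : 0 < c by rewrite invr_gt0 ltr_wpDl.
  exists q, (iota c%:C * w); split => //.
  - exact: (kerMl hq).
  - rewrite (normZ_real hN) ?(ltW c0)// mulrC ler_pdivrMr ?ltr_wpDl//.
    by rewrite mul1r lerDl.
  - apply: contraNneq wt => h.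
    have /(congr1 (fun z => iota c^-1%:C * z)) := h.
    by rewrite mulr0 -mulrA mulrCA (scaler_realK iota _ (lt0r_neq0 c0)) => ->.
have [|c hc] := field_seminormV hq (x := t); first by rewrite gt_eqF.
pose p := t * c.
have pt : p * t = t.
  by have /eqP := ann _ hc; rewrite mulrBl mul1r subr_eq0 => /eqP.
have pp : p * p = p by rewrite {2}/p mulrA pt.
have Dp := derivation_idempotent pp.
(* Modulo the kernel [x] is a scalar, so [(x - iota l) * p = 0]; differentiate, using [D p = 0]. *)
have pD x : p * D x = 0.
  have [l xl] := gelfand_mazur hq x.
  have : (x - iota l) * p = 0 by rewrite /p mulrA ann// mul0r.
  move=> /(congr1 D); rewrite DM Dp mulr0 addr0 raddf0 raddfB/= DC subr0.
  by rewrite mulrC.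
have Np := N0 p.
suff Nt : N t = 0 by rewrite (banach_norm_eq0 hN Nt) eqxx in t0.
apply/eqP; rewrite eq_le N0 andbT.
apply: (@le_geometric _ _ _ (N p)) => n; rewrite add0r.
have p0 : 0 < (2^-1 : R) ^+ n by rewrite exprn_gt0//; lra.
have [x [_ Dx]] := ht _ p0.
have -> : t = - (p * (D x - t)) by rewrite mulrBr pt pD; ring.
rewrite (seminormN hN) (le_trans (seminormM hN _ _))//.
by rewrite ler_wpM2l.
Qed.

(* Gliding hump. With v_(k+1) = w_k ^ 2 * v_k, the element z = sum_k v_k * y_k
   satisfies q_k (D z) = q_k (D (sum_(j <= k) v_j * y_j)), because the rest of
   the series is divisible by w_k ^ 2. *)
Lemma separating_eq0 s : separating N D s -> s = 0.
Proof.
move=> hs; apply/eqP/negPn/negP => s0.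
(* The pair [vP] holds [v_k] and the sum of the earlier [v_j * y_j]. *)
have step k (vP : B * B) : exists qwy : (B -> R) * B * B, vP.1 * s != 0 ->
  let: (q, w, y) := qwy in
  [/\ primitive_seminorm q, q w = 0, N w <= 1, w ^+ 2 * vP.1 * s != 0 &
    N y <= 2^-1 ^+ k /\ k%:R <= q (D (vP.2 + vP.1 * y))].
  case: vP => v P /=; have [vs|vs] := eqVneq (v * s) 0.
    (* A dummy triple: the later fact on [st] shows that this case never occurs along the
       construction. *)
    by exists (N, 0, 0).
  have [q [w [hq qvs qw w1 wvs]]] := separating_not_minimal (separatingM v hs) vs.
  have p0 : 0 < (2^-1 : R) ^+ k by rewrite exprn_gt0//; lra.
  (* The added [q (D P)] offsets the humps already placed. *)
  have [y [y2 yL]] := separating_hump (k%:R + q (D P)) hs hq qvs p0.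
  exists (q, w, y) => _; split=> //.
    (* [B] is reduced, so [w ^ 2 * v * s] is nonzero because [w * v * s] is. *)
    apply: contraNneq wvs => h; apply/eqP/semisimple_reduced.
    have -> : (w * (v * s)) ^+ 2 = (w ^+ 2 * v * s) * (v * s) by ring.
    by rewrite h mul0r.
  split=> //; rewrite raddfD/=.
  have := seminormB hq.1 (D P + D (v * y)) (D P).
  by rewrite addrC addKr; lra.
have [f fP] := choice (fun kv : nat * (B * B) => step kv.1 kv.2).
pose next k (vP : B * B) := let: (q, w, y) := f (k, vP) in
  (w ^+ 2 * vP.1, vP.2 + vP.1 * y).
pose st := fix st k := if k is m.+1 then next m (st m) else (1 : B, 0 : B).
pose q k := (f (k, st k)).1.1; pose w k := (f (k, st k)).1.2.
pose y k := (f (k, st k)).2.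
have stS k : st k.+1 = (w k ^+ 2 * (st k).1, (st k).2 + (st k).1 * y k).
  by rewrite /w /y /= /next; case: (f _) => [[]].
have vs k : (st k).1 * s != 0.
  elim: k => [|k IH]; first by rewrite mul1r.
  have := fP (k, st k) IH; rewrite stS /w.
  by case: (f _) => [[? ?] ?] [].
have hum k : [/\ primitive_seminorm (q k), q k (w k) = 0, N (w k) <= 1,
    N (y k) <= 2^-1 ^+ k & k%:R <= q k (D (st k.+1).2)].
  have := fP (k, st k) (vs k); rewrite stS /q /w /y.
  by case: (f _) => [[? ?] ?] /= [? ? ? _ []].
have [||Y hY] := @telescoping_series (fun k => w k ^+ 2) y.
- move=> k; have [_ _ w1 _ _] := hum k.
  by rewrite (le_trans (seminormX hN _ _))// expr_le1 ?N0.
- by move=> k; have [] := hum k.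
have Y0 k : Y 0%N = (st k).2 + (st k).1 * Y k.
  elim: k => [|k IH]; first by rewrite /= add0r mul1r.
  by rewrite stS IH (hY k)/=; ring.
have big k : k%:R <= N (D (Y 0%N)).
  have [[hq qN] qw _ _ qk] := hum k; rewrite (le_trans _ (qN _))//.
  rewrite (Y0 k.+1) raddfD; apply: (le_trans qk).
  rewrite le_eqVlt; apply/orP; left; apply/eqP.
  apply: (seminorm_congr hq); rewrite opprD addNKr (seminormN hq).
  (* Squaring [w k] leaves a factor [w k] in both Leibniz terms, so [q k] kills them. *)
  rewrite stS /= -mulrA expr2 -mulrA DM.
  by apply: (kerD hq); [apply: (kerMl hq)|]; exact: (kerMr hq).
have := big (Num.truncn (N (D (Y 0%N)))).+1.
by rewrite leNgt truncnS_gt.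
Qed.

Theorem semisimple_derivation_eq0 x : D x = 0.
Proof.
have [C C0 hC] := closed_graph hN DZ separating_eq0.
apply/eqP/negPn/negP => /semisimple[q [hq qN]].
by rewrite (bounded_derivation_ker hN DM DC C0 hC hq qN) ltxx.
Qed.

End SemisimpleDerivation.

(** * Quotient norms modulo maximal ideals *)

Section QuotientSeminorm.
Variables (R : realType) (B : comPzRingType) (iota : {rmorphism R[i] -> B}).
Variables (N : B -> R) (hN : banach_norm iota N).
Implicit Types (x y : B).

Let N0 := seminorm_ge0 hN.

(** The series of the [y ^+ n.+1] solves [x = y + y * x], and then [1 + x] is the inverse. *)
Lemma neumann y : N y <= 1 / 2 -> exists x, (1 - y) * x = 1.
Proof.
move=> y2.
have yX n : N (y ^+ n.+1) <= 2^-1 ^+ n.+1.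
  by rewrite (le_trans (seminormX hN _ _))// lerXn2r ?nnegrE ?N0//; lra.
have [n|x hx] := @banach_norm_complete _ _ _ _ hN (fun n => y ^+ n.+1).
  by rewrite (le_trans (yX n))// ler_wiXn2l//; lra.
suff xy : x = y + y * x.
  by exists (1 + x); rewrite mulrDr mulr1 mulrBl mul1r {1}xy; ring.
apply/subr0_eq/(banach_norm_eq0 hN)/eqP; rewrite eq_le N0 andbT.
apply: (@le_geometric _ _ _ 2) => n; rewrite add0r.
have S : \sum_(i < n.+1) y ^+ i.+1 = y + y * \sum_(i < n) y ^+ i.+1.
  by rewrite big_ord_recl expr1 mulr_sumr; congr (_ + _).
have -> : x - (y + y * x) = (x - \sum_(i < n.+1) y ^+ i.+1)
    - y * (x - \sum_(i < n) y ^+ i.+1) by rewrite S; ring.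
have h1 := hx n.+1; have h2 := hx n; rewrite exprS in h1.
have h3 := seminormM hN y (x - \sum_(i < n) y ^+ i.+1).
have h4 : N y * N (x - \sum_(i < n) y ^+ i.+1) <=
    1 / 2 * N (x - \sum_(i < n) y ^+ i.+1) by rewrite ler_wpM2r.
by rewrite (le_trans (seminormB hN _ _))//; lra.
Qed.

Variable M : set B.
Hypotheses (M0 : M 0) (MD : forall x y, M x -> M y -> M (x + y))
  (MM : forall x y, M y -> M (x * y)) (M1 : ~ M 1)
  (MV : forall x, ~ M x -> exists y, M (x * y - 1)).

Definition quotient_seminorm x := inf [set N (x - m) | m in M].

Let q := quotient_seminorm.

Let has_inf_q x : has_inf [set N (x - m) | m in M].
Proof. by split; [exists (N (x - 0)), 0|exists 0 => _ [m _ <-]]. Qed.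

Let q_le x m : M m -> q x <= N (x - m).
Proof. by move=> Mm; apply: ge_inf; [exact: (has_inf_q x).2|exists m]. Qed.

Let q_ge x (c : R) : (forall m, M m -> c <= N (x - m)) -> c <= q x.
Proof.
by move=> h; apply: lb_le_inf; [exact: (has_inf_q x).1|move=> _ [m Mm <-]; exact: h].
Qed.

Let q_approx x n : exists2 m, M m & N (x - m) <= q x + 2^-1 ^+ n.
Proof.
have p0 : 0 < (2^-1 : R) ^+ n by rewrite exprn_gt0//; lra.
by have [_ [m Mm <-] /ltW h] := inf_adherent p0 (has_inf_q x); exists m.
Qed.

Let q_ge0 x : 0 <= q x.
Proof. by apply: q_ge => m _; exact: N0. Qed.

Let q0 m : M m -> q m = 0.
Proof.
move=> Mm; apply/eqP; rewrite eq_le q_ge0 andbT.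
by rewrite (le_trans (q_le m Mm))// subrr (seminorm0 hN).
Qed.

Let qZ_le l x : q (iota l * x) <= cmod l * q x.
Proof.
apply: (@le_geometric _ _ _ (cmod l)) => n.
have [m Mm hm] := q_approx x n.
rewrite (le_trans (q_le _ (MM (iota l) Mm)))// -mulrBr (seminormZ hN) -mulrDr.
by rewrite ler_wpM2l ?normc_ge0.
Qed.

Let q_alg : alg_seminorm iota q.
Proof.
split=> [x y|x y|l x].
- apply: (@le_geometric _ _ _ 2) => n.
  have [m Mm hm] := q_approx x n; have [m' Mm' hm'] := q_approx y n.
  rewrite (le_trans (q_le _ (MD Mm Mm')))//.
  have -> : x + y - (m + m') = (x - m) + (y - m') by ring.
  by rewrite (le_trans (seminormD hN _ _))//; lra.
- apply: (@le_geometric _ _ _ (q x + q y + 1)) => n.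
  have [m Mm hm] := q_approx x n; have [m' Mm' hm'] := q_approx y n.
  rewrite (le_trans (q_le _ (MD (MM y Mm) (MM (x - m) Mm'))))//.
  have -> : x * y - (y * m + (x - m) * m') = (x - m) * (y - m') by ring.
  rewrite (le_trans (seminormM hN _ _))// (le_trans (ler_pM (N0 _) (N0 _) hm hm'))//.
  have p0 : 0 <= (2^-1 : R) ^+ n by rewrite exprn_ge0//; lra.
  have p1 : (2^-1 : R) ^+ n <= 1 by rewrite exprn_ile1//; lra.
  by have := q_ge0 x; have := q_ge0 y; nra.
- apply/eqP; rewrite eq_le qZ_le/=.
  have [->|l0] := eqVneq l 0; first by rewrite Normc.normc0 mul0r q_ge0.
  have c0 : 0 < cmod l.
    rewrite lt_neqAle normc_ge0 eq_sym andbT.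
    by apply: contra_neq l0 => /Normc.eq0_normc.
  rewrite mulrC -ler_pdivlMr// mulrC -Normc.normcV.
  apply: le_trans (qZ_le _ _).
  by rewrite mulrA -rmorphM mulVf// rmorph1 mul1r.
Qed.

(** An [m] in [M] within 1/2 of 1 would be invertible by the Neumann series, putting 1 in [M]; hence
    [q 1 >= 1 / 2]. *)
Lemma quotient_seminorm_primitive : primitive_seminorm iota N q.
Proof.
split; last by move=> x; rewrite (le_trans (q_le x M0))// subr0.
split=> // [|x qx].
  have h : 1 / 2 <= q 1; last lra.
  apply: q_ge => m Mm; rewrite leNgt; apply/negP => /ltW /neumann[x].
  by rewrite subKr mulrC => mx; apply: M1; rewrite -mx; exact: MM.
have [|y hy] := MV (x := x); last by exists y; exact: q0.
by move=> /q0 /eqP; apply/negP.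
Qed.

Lemma quotient_seminorm_gt0 x : ~ M x -> 0 < q x.
Proof.
move=> /MV[y /q0 hy]; have := seminormM q_alg x y.
rewrite (seminorm_congr q_alg hy).
have := field_seminorm1 quotient_seminorm_primitive.1.
by have := q_ge0 x; have := q_ge0 y; nra.
Qed.

End QuotientSeminorm.

(** * The commutative unital Banach algebra e A *)

Section Corner.
Variables (R : realType) (A : banachAlgType R).
Implicit Types (a b x : A).

Lemma bmul0r a : a ** 0 = 0.
Proof. by rewrite -(scale0r 0) bmulZr !scale0r. Qed.

Lemma bmulNr a b : a ** (- b) = - (a ** b).
Proof. by rewrite -scaleN1r bmulZr scaleN1r. Qed.

Lemma bmulBr a b x : a ** (b - x) = a ** b - a ** x.
Proof. by rewrite bmulDr bmulNr. Qed.

Variables (e : A) (he : right_identity e) (hc : commutative_on (left_multiples e)).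

(** [e] is idempotent, which turns e A into an equational subset, where [e] acts as a unit. *)
Lemma left_multiplesP x : left_multiples e x <-> e ** x = x.
Proof.
split=> [[a _ <-]|<-]; last by exists x.
by rewrite bmulA he.
Qed.

(* he and hc are phantom arguments: the ring structure on e A depends on them. *)
Definition corner : predArgType :=
  let _ := (he, hc) in {x : A | e ** x == x}.

HB.instance Definition _ := Choice.copy corner {x : A | e ** x == x}.

Definition cval (x : corner) : A := sval x.
Lemma cvalP (x : corner) : e ** cval x = cval x.
Proof. exact/eqP/(svalP x). Qed.

Lemma cval_inj : injective cval.
Proof. exact: val_inj. Qed.

Definition Corner (x : A) (h : e ** x = x) : corner :=
  @exist A (fun y => e ** y == y) x (introT eqP h).

Fact corner0P : e ** 0 = 0. Proof. exact: bmul0r. Qed.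
Fact cornerNP (x : corner) : e ** - cval x = - cval x.
Proof. by rewrite bmulNr cvalP. Qed.
Fact cornerDP (x y : corner) : e ** (cval x + cval y) = cval x + cval y.
Proof. by rewrite bmulDr !cvalP. Qed.
Fact corner1P : e ** e = e. Proof. exact: he. Qed.
Fact cornerMP (x y : corner) : e ** (cval x ** cval y) = cval x ** cval y.
Proof. by rewrite bmulA cvalP. Qed.

Definition corner0 := Corner corner0P.
Definition cornerN (x : corner) := Corner (cornerNP x).
Definition cornerD (x y : corner) := Corner (cornerDP x y).
Definition corner1 := Corner corner1P.
Definition cornerM (x y : corner) := Corner (cornerMP x y).

Fact cornerDA : associative cornerD.
Proof. by move=> x y z; apply: cval_inj; exact: addrA. Qed.
Fact cornerDC : commutative cornerD.
Proof. by move=> x y; apply: cval_inj; exact: addrC. Qed.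
Fact corner0D : left_id corner0 cornerD.
Proof. by move=> x; apply: cval_inj; exact: add0r. Qed.
Fact cornerND : left_inverse corner0 cornerN cornerD.
Proof. by move=> x; apply: cval_inj; exact: addNr. Qed.

HB.instance Definition _ := GRing.isZmodule.Build corner
  cornerDA cornerDC corner0D cornerND.

Fact cornerMA : associative cornerM.
Proof. by move=> x y z; apply: cval_inj; exact: bmulA. Qed.
Fact cornerMC : commutative cornerM.
Proof.
by move=> x y; apply: cval_inj; apply: hc; apply/left_multiplesP; exact: cvalP.
Qed.
Fact corner1M : left_id corner1 cornerM.
Proof. by move=> x; apply: cval_inj; exact: cvalP. Qed.
Fact cornerMDl : left_distributive cornerM +%R.
Proof. by move=> x y z; apply: cval_inj; exact: bmulDl. Qed.

HB.instance Definition _ := GRing.Zmodule_isComPzRing.Build corner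
  cornerMA cornerMC corner1M cornerMDl.

Fact corner_scalarP (l : R[i]) : e ** (l *: e) = l *: e.
Proof. by rewrite bmulZr he. Qed.

Definition corner_scalar (l : R[i]) : corner := Corner (corner_scalarP l).

Fact corner_scalar_additive : zmod_morphism corner_scalar.
Proof. by move=> l m; apply: cval_inj; exact: scalerBl. Qed.

Fact corner_scalar_multiplicative : monoid_morphism corner_scalar.
Proof.
split=> [|l m]; apply: cval_inj; first exact: scale1r.
by rewrite /= bmulZl bmulZr he scalerA.
Qed.

HB.instance Definition _ := GRing.isZmodMorphism.Build R[i] corner
  corner_scalar corner_scalar_additive.
HB.instance Definition _ := GRing.isMonoidMorphism.Build R[i] corner
  corner_scalar corner_scalar_multiplicative.

Definition corner_norm (x : corner) : R := rnorm (cval x).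

Lemma rnormD a b : rnorm (a + b) <= rnorm a + rnorm b.
Proof. by have := ler_normD a b; rewrite !rnormE -rmorphD/= lecR. Qed.

Lemma rnormZ (l : R[i]) a : rnorm (l *: a) = cmod l * rnorm a.
Proof.
by apply: complexI; rewrite -rnormE normrZ rmorphM/= -rnormE.
Qed.

Lemma rnorm_sub a b : rnorm (a - b) = rnorm (b - a).
Proof. by rewrite /rnorm distrC. Qed.

Lemma rnorm_eq0 a : rnorm a = 0 -> a = 0.
Proof. by move=> a0; apply/normr0_eq0; rewrite rnormE a0. Qed.

(** Converts completeness of [A], given by Cauchy filters, to the form used in [banach_norm]. *)
Lemma complete_series (u : nat -> A) : (forall n, rnorm (u n) <= 2^-1 ^+ n) ->
  exists x, forall n, rnorm (x - \sum_(i < n) u i) <= 2 * 2^-1 ^+ n.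
Proof.
move=> hu; pose S n := \sum_(i < n) u i.
have SS n m : rnorm (S (n + m)%N - S n) <= 2 * 2^-1 ^+ n - 2 * 2^-1 ^+ (n + m).
  elim: m => [|m IH].
    by rewrite addn0 !subrr /rnorm normr0.
  rewrite addnS /S big_ord_recr/= -/(S (n + m)%N) addrAC.
  rewrite (le_trans (rnormD _ _))// exprS.
  by have := hu (n + m)%N; lra.
have p0 n : 0 < (2^-1 : R) ^+ n by rewrite exprn_gt0//; lra.
have small (eps : R) : 0 < eps -> exists n, 2 * 2^-1 ^+ n < eps.
  move=> eps0; have [|||n hn] := @small_pow R 2^-1 (eps / 3); [lra|lra|lra|].
  by exists n; lra.
have /cauchy_cvgP : cauchy (S n @[n --> \oo]).
  apply/cauchy_exP => eps eps0.
  (* Balls of [A] have radii in [R[i]]; a positive one is real. *)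
  have [er0 eR] : 0 < complex.Re eps /\ eps = (complex.Re eps)%:C.
    by split; [move: eps0; rewrite ltcE => /andP[]|rewrite RRe_real// gtr0_real].
  have [n hn] := small _ er0; exists (S n); exists n => // m /= nm.
  rewrite -ball_normE /ball_ /= rnormE eR ltcR rnorm_sub.
  by rewrite -(subnKC nm) (le_lt_trans (SS _ _))//; have := p0 (n + (m - n))%N; lra.
move=> /cvg_ex[x Sx]; exists x => n.
apply: (@le_geometric _ _ _ 1) => k; rewrite mul1r.
have : 0 < ((2^-1 : R) ^+ k)%:C by rewrite ltcR.
move: Sx => /cvgrPdist_le /[apply] -[m _ hm].
have := hm (n + m)%N (leq_addl _ _); rewrite /= rnormE lecR => h.
have -> : x - \sum_(i < n) u i = (x - S (n + m)%N) + (S (n + m)%N - S n).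
  by rewrite addrA subrK.
rewrite (le_trans (rnormD _ _))//.
by have := SS n m; have := p0 (n + m)%N; lra.
Qed.

Lemma cval_sum (u : nat -> corner) n :
  cval (\sum_(i < n) u i) = \sum_(i < n) cval (u i).
Proof.
by elim: n => [|n IH]; rewrite ?big_ord0// !big_ord_recr/= -IH.
Qed.

Lemma corner_banach_norm : banach_norm corner_scalar corner_norm.
Proof.
split=> [|x x0|u hu].
- split=> [x y|x y|l x]; first exact: rnormD; first exact: rnormM.
  by rewrite /corner_norm /= bmulZl cvalP rnormZ.
- by apply: cval_inj; exact: rnorm_eq0.
- have [x hx] := @complete_series (fun n => cval (u n)) hu.
  suff ex : e ** x = x.
    by exists (Corner ex) => n; rewrite /corner_norm /= cval_sum.
  (* The partial sums are fixed by [e], and left multiplication by [e] is continuous. *)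
  apply/subr0_eq/rnorm_eq0/eqP; rewrite eq_le rnorm_ge0 andbT.
  apply: (@le_geometric _ _ _ (2 * rnorm e + 2)) => n; rewrite add0r.
  have eS : e ** \sum_(i < n) cval (u i) = \sum_(i < n) cval (u i).
    by rewrite -cval_sum cvalP.
  have -> : e ** x - x = e ** (x - \sum_(i < n) cval (u i)) +
      (\sum_(i < n) cval (u i) - x) by rewrite bmulBr eS addrA subrK.
  rewrite (le_trans (rnormD _ _))// [rnorm (_ - x)]rnorm_sub.
  have := rnormM e (x - \sum_(i < n) cval (u i)).
  have := ler_wpM2l (rnorm_ge0 e) (hx n); have := hx n; lra.
Qed.

(** Some modular maximal left ideal of e A misses [x]. As e A is commutative with unit [e], it is a
    maximal ideal [M], and the distance to [M] is the required seminorm. *)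
Lemma corner_semisimple : semisimple (left_multiples e) ->
  forall x : corner, x != 0 ->
  exists2 q, primitive_seminorm corner_scalar corner_norm q & 0 < q x.
Proof.
move=> hss x x0; set L := left_multiples e in hss.
have LP (y : corner) : L (cval y) by apply/left_multiplesP/cvalP.
have [I [Imax Imod Ix]] : exists I,
    [/\ maximal_left_ideal L I, modular L I & ~ I (cval x)].
  apply: contrapT => h; move/eqP: x0; apply; apply: cval_inj.
  suff : jacobson_radical L (cval x) by rewrite hss.
  split=> // I Imax Imod; apply: contrapT => Ix; apply: h.
  by exists I.
have [[IL I0 ID IZ IM] IneL max] := Imax.
pose M : set corner := [set y | I (cval y)].
have M1 : ~ M 1.
  move=> I1; apply: IneL; apply/seteqP; split=> // a La.
  by rewrite -(he a); exact: IM.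
have MM (y z : corner) : M z -> M (y * z) by exact: IM.
have MV (y : corner) : ~ M y -> exists z, M (y * z - 1).
  move=> My.
  (* This is the ideal generated by [M] and [y]; maximality makes it everything, so
     [1 = m + z * y]. *)
  pose J : set A := [set a | exists (m z : corner), M m /\ a = cval (m + z * y)].
  have [|a Ia|JI|JL] := max J.
  - split.
    + by move=> a [m [z [_ ->]]].
    + by exists 0, 0; split => //; rewrite mul0r addr0.
    + move=> a b [m [z [Mm ->]]] [m' [z' [Mm' ->]]].
      exists (m + m'), (z + z'); split; first exact: ID.
      by rewrite mulrDl addrACA.
    + move=> k a [m [z [Mm ->]]].
      exists (corner_scalar k * m), (corner_scalar k * z); split; first exact: MM.
      by rewrite -mulrA -mulrDr /= bmulZl [in RHS]bmulDr cvalP bmulA cvalP.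
    + move=> b a Lb [m [z [Mm ->]]].
      have eb : e ** b = b by apply/left_multiplesP.
      exists (Corner eb * m), (Corner eb * z); split; first exact: MM.
      by rewrite -mulrA -mulrDr.
  - have ea : e ** a = a by apply/left_multiplesP/IL.
    by exists (Corner ea), 0; split => //; rewrite mul0r addr0.
  - exfalso; apply: My; rewrite /M /= -JI.
    by exists 0, 1; split => //; rewrite mul1r add0r.
  - have [m [z [Mm mz]]] : J (cval 1) by rewrite JL.
    have me : m = 1 - z * y by rewrite (cval_inj mz) addrK.
    by exists z; rewrite (_ : _ - 1 = - 1 * m); [exact: MM|rewrite me; ring].
have hM : forall y z : corner, M y -> M z -> M (y + z) by move=> y z; exact: ID.
exists (quotient_seminorm corner_norm M).
- exact: (quotient_seminorm_primitive corner_banach_norm I0 hM MM M1 MV).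
- exact: (quotient_seminorm_gt0 corner_banach_norm I0 hM MM M1 MV Ix).
Qed.

(** * Jordan derivations of A *)

Section JordanDerivation.
Variables (d : {linear A -> A}) (hd : jordan_derivation d).

Lemma jordan_polarization a b :
  d (a ** b) + d (b ** a) = d a ** b + a ** d b + (d b ** a + b ** d a).
Proof.
have := hd (a + b); rewrite raddfD/= !bmulDl !bmulDr !raddfD/= !hd.
rewrite [LHS](AC (3*(1*2)) ((1*2*(5*6))*(3*4))).
by rewrite [RHS](AC ((2*2)*(2*2)) ((1*5*(4*8))*(2*6*(3*7)))) => /addrI.
Qed.

Fact corner_derivationP (x : corner) : e ** (e ** d (cval x)) = e ** d (cval x).
Proof. by rewrite bmulA he. Qed.

Definition corner_derivation (x : corner) := Corner (corner_derivationP x).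

Fact corner_derivation_additive : zmod_morphism corner_derivation.
Proof. by move=> x y; apply: cval_inj; rewrite /= raddfB bmulBr. Qed.

HB.instance Definition _ := GRing.isZmodMorphism.Build corner corner
  corner_derivation corner_derivation_additive.

Lemma corner_double_inj (x y : corner) : x + x = y + y -> x = y.
Proof.
have half (z : corner) : z = corner_scalar 2^-1 * (z + z).
  by rewrite mulrDr -mulrDl -rmorphD -[2^-1]div1r -splitr rmorph1 mul1r.
by move=> xy; rewrite (half x) xy -half.
Qed.

Lemma bmul_e a b : a ** (e ** b) = a ** b.
Proof. by rewrite bmulA he. Qed.

(** Left multiplication by [e] carries the polarized identity into e A, where commutativity turns it
    into twice the Leibniz rule. *)
Lemma corner_derivationM (x y : corner) :
  corner_derivation (x * y) = corner_derivation x * y + x * corner_derivation y.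
Proof.
have H : corner_derivation (x * y) + corner_derivation (y * x) =
    corner_derivation x * y + x * corner_derivation y +
    (corner_derivation y * x + y * corner_derivation x).
  apply: cval_inj; rewrite /= !bmul_e.
  have := congr1 (bmul e) (jordan_polarization (cval x) (cval y)).
  by rewrite !bmulDr !(bmulA e) !cvalP.
by apply: corner_double_inj; rewrite {2}[x * y]mulrC H; ring.
Qed.

Lemma corner_derivation_scalar l : corner_derivation (corner_scalar l) = 0.
Proof.
apply: cval_inj; rewrite /= linearZ bmulZr.
have := derivation_idempotent corner_derivationM (mulr1 1).
by move=> /(congr1 cval) /= ->; rewrite scaler0.
Qed.

Lemma jordan_left_multiples : semisimple (left_multiples e) ->
  forall a, e ** a = a -> e ** d a = 0.
Proof.
move=> hss a ea.
have := semisimple_derivation_eq0 corner_banach_norm (corner_semisimple hss)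
  corner_derivationM corner_derivation_scalar (Corner ea).
by move=> /(congr1 cval).
Qed.

Hypothesis d_corner : forall a, e ** a = a -> e ** d a = 0.

Lemma jordan_range a x : x ** d a = 0.
Proof.
suff ed b : e ** d b = 0 by rewrite -bmul_e ed bmul0r.
(* Polarizing [e] and [r] leaves [d r = e ** d r + d r]. *)
have er r : e ** r = 0 -> e ** d r = 0.
  move=> r0; have := jordan_polarization e r.
  rewrite r0 raddf0 add0r !he -(bmul_e (d e)) r0 bmul0r add0r.
  have -> : r ** d e = 0 by rewrite -bmul_e d_corner ?he// bmul0r.
  by rewrite addr0 -{1}[d r]add0r => /addIr/esym.
rewrite -(subrK (e ** b) b) raddfD bmulDr er ?d_corner ?addr0//.
  by rewrite bmul_e.
by rewrite bmulBr bmul_e subrr.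
Qed.

(** As [d] maps into ran(A), polarization reads [d (u ** v) + d (v ** u) = d u ** v + d v ** u].
    Pairing with [e] settles products with left factor [e]. In [a = r + e ** a], [e ** r = 0] makes
    [b ** r] vanish, which settles [r ** b]. *)
Lemma jordan_derivation_derivation : derivation d.
Proof.
move=> a b; rewrite jordan_range addr0.
have pol u v : d (u ** v) + d (v ** u) = d u ** v + d v ** u.
  by rewrite jordan_polarization !jordan_range !addr0.
have de u : d (e ** u) = d e ** u.
  by have := pol u e; rewrite !he addrC [RHS]addrC => /addIr.
pose r := a - e ** a.
have r0 : e ** r = 0 by rewrite bmulBr bmul_e subrr.
have dr : d (r ** b) = d r ** b.
  have := pol r b; rewrite -(bmul_e b r) -(bmul_e (d b) r) r0 !bmul0r.
  by rewrite raddf0 !addr0.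
have ra : a = r + e ** a by rewrite subrK.
clearbody r; rewrite {1 2}ra bmulDl !raddfD/= dr -bmulA !de.
by rewrite bmulDl bmulA.
Qed.

Lemma jordan_spectrally_infinitesimal : spectrally_infinitesimal d.
Proof.
move=> a; have sq0 n : bpowS (d a) n.+1 = 0.
  elim: n => [|n IH]; first exact: jordan_range.
  by rewrite /bpowS iterS -/(bpowS _ n.+1) IH bmul0r.
(* Index 1 is exponent 2, from which on all powers of [d a] vanish. *)
apply: lim_near_cst => //; exists 1%N => // -[//|n] _.
by rewrite /spectral_seq sq0 /rnorm normr0 powR0// invr_eq0 pnatr_eq0.
Qed.

End JordanDerivation.
End Corner.

Theorem theorem2p2 (R : realType) (A : banachAlgType R) (e : A)
    (he : right_identity e)
    (hcomm : commutative_on (left_multiples e))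
    (hss : semisimple (left_multiples e))
    (d : {linear A -> A}) (hd : jordan_derivation d) :
  [/\ derivation d, spectrally_infinitesimal d
    & range d `<=` right_annihilator A].
Proof.
have dB := jordan_left_multiples he hcomm hd hss.
split.
- exact: (jordan_derivation_derivation he hd dB).
- exact: (jordan_spectrally_infinitesimal he hd dB).
- by move=> _ [a _ <-] x; exact: (jordan_range he hd dB).
Qed.
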